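(* Let $f:\mathbb{Z}_+\to(0,1]$ be an arbitrary function. Then there exist a number $\gamma\in(0,1)$ and a function $g:\mathbb{Z}_+\to(0,1]$ with $0<g(x)<f(x)$ for all $x\in\mathbb{Z}_+$ such that for every real number $\alpha$ the following holds: if the inequality $$\left|\alpha-\frac{p}{q}\right|<\frac{\gamma\cdot f(q)}{q^2}$$ has infinitely many solutions in rationals $\frac{p}{q}$ (with $p\in\mathbb{Z}$, $q\in\mathbb{Z}_+$), then the stronger inequality $$\left|\alpha-\frac{p}{q}\right|<\frac{\gamma\cdot f(q)-g(q)}{q^2}$$ also has infinitely many solutions in rationals $\frac{p}{q}$.
   Context: $\mathbb{Z}_+$ denotes the set of positive integers. The function $g$ depends only on $f$ (not on $\alpha$). *)

(* Defs.v *)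
From mathcomp Require Import all_boot all_order all_algebra.
From mathcomp Require Import boolp classical_sets cardinality reals.

Set Implicit Arguments.
Unset Strict Implicit.
Unset Printing Implicit Defensive.

Import Order.TTheory GRing.Theory Num.Theory.

Local Open Scope classical_set_scope.
Local Open Scope ring_scope.

(* The rational numbers solving |alpha - p/q| < psi(q) / q^2.  The right-hand
   side depends on the representation p/q, which need not be in lowest terms;
   solutions are counted as elements of rat, so different representations of
   one rational number count once. *)
Definition rat_solutions (R : realType) (psi : nat -> R) (alpha : R) : set rat :=
  [set r : rat | exists (p : int) (q : nat),
    [/\ (0 < q)%N, r = p%:~R / q%:R
      & `|alpha - p%:~R / q%:R| < psi q / q%:R ^+ 2]].

(* Main.v *)
(* A counterexample alpha lies, for infinitely many p/q, in the thin layer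
   between the two intervals around p/q, hence within g(q)/q^2 of an endpoint
   p/q +- gamma f(q)/q^2.  By Baire's theorem gamma can be chosen so that every
   such endpoint is interior to the larger interval of some p'/q' with q' > q:
   for a single endpoint this is an open condition on gamma, and it is dense
   since moving gamma slightly makes the endpoint equal to p'/q'.  If g is small
   enough, the whole layer at p/q then lies in the smaller interval of p'/q'.
   Up to integer translation there are finitely many endpoints with given q, so
   g(n) only has to meet the finitely many constraints with q <= n. *)
Require Import Defs.
From mathcomp Require Import all_boot all_order all_algebra.
From mathcomp Require Import boolp classical_sets cardinality reals.
From mathcomp Require Import topology normedtype sequences.
From mathcomp Require Import ring lra zify.

Set Implicit Arguments.
Unset Strict Implicit.
Unset Printing Implicit Defensive.

Import Order.TTheory GRing.Theory Num.Theory.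
Import numFieldNormedType.Exports.

Local Open Scope classical_set_scope.
Local Open Scope ring_scope.

(** * Infinitely many solutions versus solutions with large denominators *)

Lemma ratr_fracz (R : realType) (p : int) (q : nat) :
  ratr (p%:~R / q%:R) = p%:~R / q%:R :> R.
Proof. by rewrite fmorph_div /= ratr_int ratr_nat. Qed.

Lemma lt_expN2 (R : realType) (c x : R) (q : nat) :
  (0 < q)%N -> c <= 1 -> x < c / q%:R ^+ 2 -> x < q%:R ^- 2.
Proof.
move=> q0 hc /lt_le_trans; apply.
by rewrite ler_piMl // invr_ge0 exprn_ge0.
Qed.

Lemma natr_expN2_le1 (R : realType) (q : nat) : (0 < q)%N -> q%:R ^- 2 <= 1 :> R.
Proof.
move=> q0; rewrite invf_le1 ?exprn_gt0 ?ltr0n //.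
by rewrite exprn_ege1 // ler1n.
Qed.

Lemma finite_bounded_denominator (R : realType) (alpha : R) (N : nat) :
  finite_set [set r : rat | exists (p : int) (q : nat),
    [/\ (0 < q <= N)%N, r = p%:~R / q%:R & `|alpha - p%:~R / q%:R| < 1]].
Proof.
pose M := Num.truncn (N%:R * (`|alpha| + 1)).
(* The shift by [M] lets natural numbers up to [M + M] encode all numerators in [[-M, M]]. *)
pose h (x : nat * nat) : rat := ((x.1)%:Z - M%:Z)%:~R / x.2%:R.
apply: (@sub_finite_set _ _ (h @` (`I_((M + M).+1) `*` `I_N.+1))); last first.
  by apply: finite_image; apply: finite_setX; exact: finite_II.
move=> _ [p [q [/andP[q0 qN] -> hd]]].
have q0R : 0 < q%:R :> R by rewrite ltr0n.
have qNR : q%:R <= N%:R :> R by rewrite ler_nat.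
have pM : (`|p| <= M)%N.
  rewrite -ltnS -(ltr_nat R) natr_absz intr_norm.
  apply: le_lt_trans (truncnS_gt _).
  have -> : p%:~R = q%:R * (p%:~R / q%:R) :> R by field; rewrite gt_eqF.
  rewrite normrM (gtr0_norm q0R); apply: ler_pM => //.
  have := ler_normB alpha (alpha - p%:~R / q%:R).
  by rewrite subKr; lra.
exists (absz (p + M%:Z), q); first by split => /=; lia.
by rewrite /h /=; congr (_%:~R / _); lia.
Qed.

Lemma rat_solutions_large_denominator (R : realType) (psi : nat -> R) (alpha : R)
    (psi_le1 : forall q, (0 < q)%N -> psi q <= 1) :
  infinite_set (rat_solutions psi alpha) -> forall N : nat,
  exists (p : int) (q : nat),
    (N < q)%N /\ `|alpha - p%:~R / q%:R| < psi q / q%:R ^+ 2.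
Proof.
move=> inf N; apply: contrapT => noq; apply: inf.
apply: sub_finite_set (finite_bounded_denominator alpha N).
move=> r [p [q [q0 rE hd]]]; exists p, q; split=> //.
  rewrite q0 /= leqNgt; apply/negP => Nq; apply: noq.
  by exists p, q.
by apply: lt_le_trans (natr_expN2_le1 R q0); apply: lt_expN2 hd => //; exact: psi_le1.
Qed.

(** If [alpha = r], a fraction p/q other than [r] is at distance at least 1/(q * [denq r]) from it,
    so being closer than 1/q^2 forces q < [denq r]. The rational [r] itself is set apart, since its
    unreduced representations have unbounded denominators. *)
Lemma rat_solutions_irrational (R : realType) (psi : nat -> R) (alpha : R)
    (psi_le1 : forall q, (0 < q)%N -> psi q <= 1) :
  infinite_set (rat_solutions psi alpha) -> forall r : rat, alpha <> ratr r.
Proof.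
move=> inf r alphaE; apply: inf.
set N := `|denq r|%N.
have fin := finite_bounded_denominator alpha N.
apply: sub_finite_set (_ : finite_set ([set r] `|` _)); last first.
  by rewrite finite_setU; split; [exact: finite_set1|exact: fin].
move=> s [p [q [q0 sE hd]]].
have hd2 := lt_expN2 q0 (psi_le1 q q0) hd.
have [->|sr] := eqVneq s r; [by left|right].
exists p, q; split=> //; last exact: lt_le_trans hd2 (natr_expN2_le1 R q0).
rewrite q0 /=.
have q0Q : 0 < q%:R :> rat by rewrite ltr0n.
have d0 : 0 < (denq r)%:~R :> rat by rewrite ltr0z denq_gt0.
have hQ : `|r - p%:~R / q%:R| < q%:R ^- 2.
  rewrite -(ltr_rat R) fmorphV rmorphXn /= ratr_nat.
  by rewrite ratr_norm rmorphB /= ratr_fracz -alphaE.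
have nE : r - p%:~R / q%:R = (numq r * q%:Z - p * denq r)%:~R / ((denq r)%:~R * q%:R).
  rewrite -{1}(divq_num_den r) rmorphB !rmorphM /=; field.
  by rewrite !gt_eqF.
have n0 : numq r * q%:Z - p * denq r != 0.
  apply: contraNneq sr => n0; move: nE; rewrite n0 mul0r => /eqP.
  by rewrite subr_eq0 sE eq_sym.
move: hQ; rewrite nE normrM normfV (@gtr0_norm _ (_ * _)) ?mulr_gt0 //.
rewrite ltr_pdivrMr ?mulr_gt0 // => hQ.
have : 1 <= `|(numq r * q%:Z - p * denq r)%:~R| :> rat.
  by rewrite -intr_norm ler1z; lia.
move=> /le_lt_trans /(_ hQ).
have -> : q%:R ^- 2 * ((denq r)%:~R * q%:R) = (denq r)%:~R / q%:R :> rat.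
  by field; rewrite gt_eqF.
rewrite ltr_pdivlMr // mul1r.
have -> : q%:R = q%:Z%:~R :> rat by [].
by rewrite ltr_int /N; lia.
Qed.

(** Large denominators alone could all represent one rational. Irrationality excludes this: finitely
    many rationals stay at some distance [e > 0] from [alpha], while a solution with q > 1/e is
    closer than 1/q^2 <= 1/q < e. *)
Lemma infinite_rat_solutions (R : realType) (psi : nat -> R) (alpha : R)
    (psi_le1 : forall q, (0 < q)%N -> psi q <= 1) :
  (forall r : rat, alpha <> ratr r) ->
  (forall N : nat, exists (p : int) (q : nat),
    (N < q)%N /\ `|alpha - p%:~R / q%:R| < psi q / q%:R ^+ 2) ->
  infinite_set (rat_solutions psi alpha).
Proof.
move=> irr large /finite_seqP[s sE].
have [e e0 es] : exists2 e : R, 0 < e & forall r, r \in s -> e <= `|alpha - ratr r|.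
  elim: s {sE} => [|r s [e e0 es]]; first by exists 1.
  exists (Num.min e `|alpha - ratr r|).
    by rewrite lt_min e0 normr_gt0 subr_eq0; apply/eqP; exact: irr.
  move=> t; rewrite inE => /predU1P[->|/es]; first by rewrite ge_min lexx orbT.
  by rewrite ge_min => ->.
have [p [q [Nq hd]]] := large (Num.truncn e^-1).
have q0 : (0 < q)%N by lia.
have : rat_solutions psi alpha (p%:~R / q%:R) by exists p, q.
rewrite sE => /= /es; rewrite ratr_fracz.
have hd2 := lt_expN2 q0 (psi_le1 q q0) hd.
have q1 : 1 <= q%:R :> R by rewrite ler1n.
have eq : e^-1 < q%:R.
  by apply: lt_le_trans (truncnS_gt _) _; rewrite ler_nat.
have : q%:R ^- 2 <= q%:R^-1 :> R.
  by rewrite lef_pV2 ?posrE ?exprn_gt0 ?ltr0n // expr2 ler_peMr // ler0n.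
have : q%:R^-1 < e by rewrite invf_plt ?posrE ?ltr0n.
by lra.
Qed.

(** * Openness and density of the conditions on [gamma] *)

Lemma open_approximable (R : realType) (psi : nat -> R) (a w : R) (N : nat) :
  (forall q, (N < q)%N -> 0 < psi q) ->
  open [set x : R | exists (p : int) (q : nat),
    (N < q)%N /\ `|a + x * w - p%:~R / q%:R| < `|x| * psi q].
Proof.
move=> psi0; rewrite openE => x [p [q [Nq hx]]].
apply/nbhs_ballP.
set m := `|x| * psi q - `|a + x * w - p%:~R / q%:R|.
have m0 : 0 < m by rewrite subr_gt0.
have k0 : 0 < psi q + `|w| by rewrite ltr_wpDr // psi0.
(* For fixed [p], [q] the two sides are Lipschitz in [x] with constants [|w|] and [psi q], so the
   slack [m] survives within this radius. *)
exists (m / (psi q + `|w|)); first by rewrite /= divr_gt0.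
move=> y; rewrite /ball /= ltr_pdivlMr // => hy; exists p, q; split => //.
have : `|a + y * w - p%:~R / q%:R| <= `|a + x * w - p%:~R / q%:R| + `|x - y| * `|w|.
  rewrite -normrM -[X in _ <= _ + X]normrN.
  apply: le_trans (ler_normD _ _); rewrite le_eqVlt; apply/orP; left.
  by apply/eqP; congr `|_|; ring.
have : `|x| * psi q <= `|y| * psi q + `|x - y| * psi q.
  rewrite -mulrDl; apply: ler_wpM2r; first by rewrite ltW ?psi0.
  by have := ler_normD (x - y) y; rewrite subrK; lra.
by move: hy; rewrite /m mulrDr; lra.
Qed.

Lemma dense_approximable (R : realType) (psi : nat -> R) (a w : R) (N : nat) :
  w != 0 -> (forall q, (N < q)%N -> 0 < psi q) ->
  dense [set x : R | exists (p : int) (q : nat),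
    (N < q)%N /\ `|a + x * w - p%:~R / q%:R| < `|x| * psi q].
Proof.
move=> w0 psi0 O [x Ox] oO.
have /nbhs_ballP[e /= e0 eO] : nbhs x O by apply: open_nbhs_nbhs; split.
have ew : 0 < e * `|w| by rewrite mulr_gt0 // normr_gt0.
(* Choosing [r] beyond [a + x * w], on the side away from [a], ensures [r != a]; the new [x] is then
   nonzero and the right-hand side positive. *)
have [r ra rx] : exists2 r : rat, ratr r != a & `|a + x * w - ratr r| < e * `|w|.
  have [t0|t0] := leP 0 (x * w).
    have /rat_in_itvoo[r] : a + x * w < a + x * w + e * `|w| by lra.
    rewrite in_itv /= => /andP[r1 r2]; exists r; first by rewrite gt_eqF //; lra.
    by rewrite ltr_norml; lra.
  have /rat_in_itvoo[r] : a + x * w - e * `|w| < a + x * w by lra.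
  rewrite in_itv /= => /andP[r1 r2]; exists r; first by rewrite lt_eqF //; lra.
  by rewrite ltr_norml; lra.
exists ((ratr r - a) / w); split.
  apply: eO; rewrite /ball /=.
  have -> : x - (ratr r - a) / w = (a + x * w - ratr r) / w by field.
  by rewrite normrM normfV ltr_pdivrMr ?normr_gt0.
have d0 : (0 < `|denq r|)%N by have := denq_gt0 r; lia.
(* An unreduced representation of [r] makes the denominator exceed [N]. *)
exists (numq r * N.+1%:Z), (`|denq r| * N.+1)%N; split; first by nia.
have -> : (numq r * N.+1%:Z)%:~R / (`|denq r| * N.+1)%:R = ratr r :> R.
  rewrite -{3}(divq_num_den r) fmorph_div /= !ratr_int natrM rmorphM /=.
  rewrite natr_absz (gtr0_norm (denq_gt0 r)).
  by rewrite -[N.+1%:Z%:~R]/(N.+1%:R) -mulf_div divff ?mulr1 ?pnatr_eq0.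
rewrite divfK // addrCA subrr addr0 subrr normr0 mulr_gt0 ?psi0 //; last by nia.
by rewrite normr_gt0 mulf_neq0 ?invr_eq0 ?subr_eq0.
Qed.

Lemma Baire_countable (R : realType) (T : countType) (F : T -> set R) :
  (forall t, open (F t)) -> (forall t, dense (F t)) ->
  dense [set x | forall t, F t x].
Proof.
move=> oF dF.
pose G n := if unpickle n is Some t then F t else [set: R].
have dG : dense (\bigcap_n G n).
  apply: Baire => n; rewrite /G; case: (unpickle n) => [t|].
    by split; [exact: oF|exact: dF].
  by split; [exact: openT|move=> O [x Ox] _; exists x].
move=> O nO oO; have [x [Ox Gx]] := dG O nO oO.
by exists x; split=> // t; have := Gx (pickle t) I; rewrite /G pickleK.
Qed.

Lemma positive_diagonal_minorant (R : realType) (d : nat * nat * bool -> R)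
    (f : nat -> R) :
  (forall t, 0 < d t) -> (forall n, (0 < n)%N -> 0 < f n) ->
  exists g : nat -> R, [/\ forall n, (0 < n)%N -> 0 < g n,
    forall n, g n <= f n
    & forall n i j s, (i <= n)%N -> (j <= n)%N -> g n <= d (i, j, s)].
Proof.
move=> d0 f0.
pose D n (t : 'I_n.+1 * 'I_n.+1 * bool) := d (nat_of_ord t.1.1, nat_of_ord t.1.2, t.2).
exists (fun n => \big[Order.min/f n]_t @D n t); split=> [n n0|n|n i j s ni nj].
- by apply: lt_bigmin => [|t _]; [exact: f0|exact: d0].
- exact: bigmin_le_id.
- apply: le_trans (bigmin_le _ (inord i, inord j, s) _) _.
  by rewrite /D /= !inordK.
Qed.

(** The sign selects the endpoint of the interval around [a] lying on the same side as [x]. *)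
Lemma dist_endpoint_le (R : realType) (x a c e : R) :
  `|x - a| < c -> c - e <= `|x - a| ->
  `|x - (a + (-1) ^+ (x < a)%R * c)| <= e.
Proof.
case: (ltP x a) => [xa|ax].
  by rewrite ltr0_norm ?subr_lt0 //= expr1 mulN1r ler_norml; lra.
by rewrite ger0_norm ?subr_ge0 //= expr0 mul1r ler_norml; lra.
Qed.

Theorem theorem1 (R : realType) (f : nat -> R)
    (hf : forall q : nat, (0 < q)%N -> 0 < f q <= 1) :
  exists (gamma : R) (g : nat -> R),
    [/\ 0 < gamma < 1,
        (forall q : nat, (0 < q)%N -> 0 < g q <= 1),
        (forall q : nat, (0 < q)%N -> 0 < g q < f q)
      & forall alpha : R,
          infinite_set (rat_solutions (fun q => gamma * f q) alpha) ->
          infinite_set (rat_solutions (fun q => gamma * f q - g q) alpha)].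
Proof.
pose psi q := f q / q%:R ^+ 2.
have psi0 q : (0 < q)%N -> 0 < psi q.
  by move=> q0; have /andP[f0 _] := hf q q0; rewrite divr_gt0 ?exprn_gt0 ?ltr0n.
(* The triple encodes the endpoint of the interval around [j / n.+1] on the side given by [s], with
   [x] in the role of [gamma]. *)
pose F (t : nat * nat * bool) : set R := let: (n, j, s) := t in
  [set x | exists (p : int) (q : nat), (n.+1 < q)%N /\
    `|j%:R / n.+1%:R + x * ((-1) ^+ s * psi n.+1) - p%:~R / q%:R| < `|x| * psi q].
have psiN N q : (N < q)%N -> 0 < psi q by move=> ?; apply: psi0; lia.
have oF t : open (F t) by case: t => [[n j] s]; apply: open_approximable (@psiN _).
have dF t : dense (F t).
  case: t => [[n j] s]; apply: dense_approximable (@psiN _).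
  by rewrite mulf_neq0 ?signr_eq0 // gt_eqF // psi0.
have [gamma [/= g01 Fg]] : [set x : R | 0 < x < 1] `&` [set x | forall t, F t x] !=set0.
  apply: (Baire_countable oF dF); first by exists (1 / 2) => /=; lra.
  have -> : [set x : R | 0 < x < 1] = `]0, 1[%classic.
    by apply/seteqP; split=> x; rewrite /= in_itv.
  exact: itv_open.
have [g0 g1] := andP g01.
(* One [d] absorbs the distance from [alpha] to the endpoint, one the loss [g q' / q'^2], and the
   third gives strictness. *)
have margin (t : nat * nat * bool) : exists d : R, 0 < d /\ let: (n, j, s) := t in
    exists (p : int) (q : nat), (n.+1 < q)%N /\
    `|j%:R / n.+1%:R + gamma * ((-1) ^+ s * psi n.+1) - p%:~R / q%:R| + d + d + d
       <= gamma * psi q.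
  case: t => [[n j] s]; have [p [q [nq hq]]] := Fg (n, j, s).
  rewrite (gtr0_norm g0) in hq.
  set u := `|_| in hq.
  exists ((gamma * psi q - u) / 3); split; first by lra.
  by exists p, q; split=> //; rewrite -/u; lra.
have [d hd] := choice margin.
(* Capping [g] by [f / 2] yields the strict bound [g < f]. *)
have hf2 n : (0 < n)%N -> 0 < f n / 2 by move=> n0; have := hf n n0; lra.
have [g [gpos gf gd]] := positive_diagonal_minorant (fun t => proj1 (hd t)) hf2.
have gsq q : (0 < q)%N -> g q / q%:R ^+ 2 <= g q.
  by move=> q0; rewrite ler_piMr ?natr_expN2_le1 // ltW // gpos.
have gfq q : (0 < q)%N -> gamma * f q <= 1.
  by move=> q0; have := hf q q0; nra.
exists gamma, g; split=> //.
- by move=> q q0; rewrite gpos //=; have := gf q; have := hf q q0; lra.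
- by move=> q q0; rewrite gpos //=; have := gf q; have := hf q q0; lra.
move=> alpha inf.
apply: infinite_rat_solutions.
- by move=> q q0; have := gfq q q0; have := gpos q q0; lra.
- exact: rat_solutions_irrational inf.
move=> N.
have [p [q [Nq hpq]]] := rat_solutions_large_denominator gfq inf N.
have q0 : (0 < q)%N by lia.
have [hg|hg] := ltP `|alpha - p%:~R / q%:R| ((gamma * f q - g q) / q%:R ^+ 2).
  by exists p, q.
case: q q0 Nq hpq hg => [//|n] _ Nq hpq hg.
(* Translation by the integer [k] brings the numerator to [j < n.+1], so that the constraint for
   [(n, j, s)] is among those met by [g n.+1]. *)
pose k := (p %/ n.+1)%Z; pose j := absz (p %% n.+1)%Z; pose s := alpha < p%:~R / n.+1%:R.
have pE : p = k * n.+1%:Z + j%:Z.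
  by rewrite /j gez0_abs ?modz_ge0 // -divz_eq.
have jn : (j < n.+1)%N.
  by have := @ltz_pmod p n.+1 isT; have := @modz_ge0 p n.+1 isT; rewrite /j; lia.
have [d0 [p' [q' [nq hq']]]] := hd (n, j, s).
have q'0 : (0 < q')%N by lia.
have gn := gd n.+1 n j s (leqnSn n) (ltnW jn).
(* As [q'] exceeds [n.+1], the same constraint also bounds [g q']. *)
have gq' : g q' <= d (n, j, s) by apply: gd; lia.
exists (p' + k * q'%:Z), q'; split; first by lia.
move: hpq hg (gsq n.+1 isT) (gsq q' q'0); rewrite !mulrBl -!mulrA -!/(psi _) => hpq hg gn2 gq2.
have pn : p%:~R / n.+1%:R = k%:~R + j%:R / n.+1%:R :> R.
  by rewrite {1}pE rmorphD rmorphM /= -!pmulrn mulrDl mulfK ?pnatr_eq0.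
have -> : (p' + k * q'%:Z)%:~R / q'%:R = k%:~R + p'%:~R / q'%:R :> R.
  by rewrite rmorphD rmorphM /=; field; rewrite pnatr_eq0 -lt0n.
set b := j%:R / n.+1%:R + _ in hq'.
have hb : `|alpha - k%:~R - b| <= g n.+1 / n.+1%:R ^+ 2.
  have -> : alpha - k%:~R - b =
      alpha - (p%:~R / n.+1%:R + (-1) ^+ s * (gamma * psi n.+1)).
    by rewrite pn /b; ring.
  exact: dist_endpoint_le.
have := ler_normD (alpha - k%:~R - b) (b - p'%:~R / q'%:R).
have -> : alpha - k%:~R - b + (b - p'%:~R / q'%:R) = alpha - (k%:~R + p'%:~R / q'%:R).
  by ring.
move: hq' hb d0 (le_trans gn2 gn) (le_trans gq2 gq').
move: (g n.+1 / _) (g q' / _) (gamma * psi q') (d _) `|b - _| `|alpha - _ - b|.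
by move=> *; lra.
Qed.
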